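(* Let $b(x)=\frac14x^4+\frac12px^2+qx$ with $p<0$ and $q\in\mathbb{R}$, and let $\Omega=\{(z_1,z_2)\in\mathbb{C}^2:\operatorname{Im}z_2>b(\operatorname{Re}z_1)\}$. For $\eta\in\mathbb{R}$, $\tau>0$ let $N(\eta,\tau)=\int_{-\infty}^{\infty}e^{2\tau[\eta\lambda-b(\lambda)]}\,d\lambda$, and let the Szeg\''o kernel of $\Omega$ be given by $$S(z,w)=c\iint_{\tau>0}\tau\, e^{\eta\tau[z_1+\bar w_1]+i\tau[z_2-\bar w_2]}[N(\eta,\tau)]^{-1}\,d\eta\,d\tau,$$ where $c$ is an absolute constant. Write $z=(x+iy,\,t+ib(x)+ih)$ and $w=(r+is,\,u+ib(r)+ik)$ with $x,y,t,r,s,u,h,k\in\mathbb{R}$. Let $b^*(\eta)=\sup_{\lambda\in\mathbb{R}}[\eta\lambda-b(\lambda)]$ be the Legendre transform of $b$ and $b^{**}$ the Legendre transform of $b^*$. Let $$\Sigma=\{(z,w): x=r\text{ and }|x|>\sqrt{-p}\}\cup\{(z,w):|x|=|r|=\sqrt{-p}\}.$$ Then the integral defining $S(z,w)$ is absolutely convergent in the region where $$h+k+b(x)+b(r)-2b^{**}\left(\tfrac{x+r}{2}\right)>0,$$ and this region is an open neighborhood of $(\overline{\Omega}\times\overline{\Omega})\setminus\Sigma$. More generally, for non-negative integers $i_1,j_1,i_2,j_2$, $$\partial^{i_1}_{z_1}\partial^{j_1}_{\bar w_1}\partial^{i_2}_{z_2}\partial^{j_2}_{\bar w_2}S(z,w)=c'\iint_{\tau>0}e^{\eta\tau[z_1+\bar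 w_1]+i\tau[z_2-\bar w_2]}\frac{\eta^{i_1+j_1}\tau^{i_1+j_1+i_2+j_2+1}}{N(\eta,\tau)}\,d\eta\,d\tau$$ (for a constant $c'$), and this integral is absolutely convergent in the same region.
   Context: $\overline{\Omega}$ is the closure of $\Omega$, i.e. points with $h\ge0$ (resp. $k\ge 0$). The Legendre transform of a function $f$ on $\mathbb{R}$ is $f^*(\eta)=\sup_{\lambda}[\eta\lambda-f(\lambda)]$. *)

(* Defs.v *)
(* MathComp + MathComp-Analysis, over an abstract R : realType;
   complex numbers are R[i] (mathcomp-real-closed, complex.v). *)
From mathcomp Require Import all_boot all_order all_algebra.
From mathcomp Require Import all_classical all_reals all_analysis.
From mathcomp Require Import complex.
Import Order.TTheory GRing.Theory Num.Theory.
Import numFieldNormedType.Exports.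
Local Open Scope ring_scope.

Set Implicit Arguments.
Unset Strict Implicit.
Unset Printing Implicit Defensive.

Section Defs.
Variable R : realType.

(* b(x) = x^4/4 + p x^2/2 + q x *)
Definition bq (p q : R) (x : R) : R := x ^+ 4 / 4 + p * x ^+ 2 / 2 + q * x.

(* Legendre transform f^*(eta) = sup_lambda [eta*lambda - f lambda],
   with values in the extended reals. *)
Definition legendre (f : R -> \bar R) (eta : R) : \bar R :=
  ereal_sup [set ((eta * l)%:E - f l)%E | l in [set: R]].

(* N(eta,tau) = int_R exp(2 tau (eta lambda - b lambda)) dlambda *)
Definition Nfun (b : R -> R) (eta tau : R) : R :=
  Rintegral (@lebesgue_measure R) [set: R]
    (fun l => expR (2 * tau * (eta * l - b l))).

(* complex exponential *)
Definition cexp (z : R[i]) : R[i] :=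
  Complex (expR (complex.Re z) * cos (complex.Im z))
          (expR (complex.Re z) * sin (complex.Im z)).

(* Lebesgue measure on R^2 (variables (eta, tau)) and the domain tau > 0 *)
Definition mu2 := ((@lebesgue_measure R) \x (@lebesgue_measure R))%E.
Definition tau_pos : set (R * R) := [set et | 0 < et.2].

(* the integrand  e^{eta tau (z1 + conj w1) + i tau (z2 - conj w2)}
                  * eta^a * tau^m / N(eta,tau),   et = (eta, tau) *)
Definition kern (b : R -> R) (a m : nat) (z w : R[i] * R[i]) (et : R * R)
  : R[i] :=
  let eta := et.1 in let tau := et.2 in
  cexp (((eta * tau)%:C)%C * (z.1 + (w.1)^*) + ('i)%C * (tau%:C)%C * (z.2 - (w.2)^*))
  * ((eta ^+ a * tau ^+ m / Nfun b eta tau)%:C)%C.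

(* absolute convergence of the (Lebesgue) integral over {tau > 0}:
   measurable integrand with finite integral of its modulus *)
Definition abs_conv (f : R * R -> R[i]) : Prop :=
  measurable_fun tau_pos (fun et => complex.Re (f et)) /\
  measurable_fun tau_pos (fun et => complex.Im (f et)) /\
  (\int[mu2]_(et in tau_pos) (ComplexField.Normc.normc (f et))%:E < +oo)%E.

(* the complex-valued integral over {tau > 0} *)
Definition Cint (f : R * R -> R[i]) : R[i] :=
  Complex (Rintegral mu2 tau_pos (fun et => complex.Re (f et)))
          (Rintegral mu2 tau_pos (fun et => complex.Im (f et))).

(* iint b a m z w = \iint_{tau>0} e^{...} eta^a tau^m / N d eta d tau *)
Definition iint (b : R -> R) (a m : nat) (z w : R[i] * R[i]) : R[i] :=
  Cint (kern b a m z w).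

(* Szego kernel S(z,w) = c \iint_{tau>0} tau e^{...} / N *)
Definition szego (b : R -> R) (c : R[i]) (z w : R[i] * R[i]) : R[i] :=
  c * iint b 0 1 z w.

(* closure of Omega:  h = Im z2 - b(Re z1) >= 0 *)
Definition Omega_bar (b : R -> R) (z : R[i] * R[i]) : Prop :=
  b (complex.Re z.1) <= complex.Im z.2.

(* the region  h + k + b(x) + b(r) - 2 b**((x+r)/2) > 0 *)
Definition region (b : R -> R) (z w : R[i] * R[i]) : Prop :=
  let x := complex.Re z.1 in let r := complex.Re w.1 in
  let h := complex.Im z.2 - b x in let k := complex.Im w.2 - b r in
  (0 < (h + k + b x + b r)%:E
        - 2%:E * legendre (legendre (fun l => (b l)%:E)) ((x + r) / 2))%E.

(* Sigma = {x = r, |x| > sqrt(-p)} u {|x| = |r| = sqrt(-p)} *)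
Definition Sigma (p : R) (z w : R[i] * R[i]) : Prop :=
  let x := complex.Re z.1 in let r := complex.Re w.1 in
  (x = r /\ Num.sqrt (- p) < `|x|) \/
  (`|x| = Num.sqrt (- p) /\ `|r| = Num.sqrt (- p)).

End Defs.

(* Main.v *)
(* With Z = z1 + conj w1 and T = z2 - conj w2 the integrand has modulus
   exp(tau (eta Re Z - Im T)) |eta|^a tau^m / N(eta,tau).  The region says that
   b^*(eta) exceeds eta Re Z/2 - Im T/2 by a fixed gap, uniformly in eta; as b
   is superlinear the gap may be taken to be e (1 + |eta|), attained at a point l
   of a fixed compact set.  Integrating over a short interval next to l gives
   1/N <= C (1 + tau) exp(-2 tau (eta l - b l)), so for a < m the integrand is
   dominated by tau exp(-d tau (1 + |eta|)), which is integrable: integrate in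
   eta first.  Complex derivatives follow from
   |exp v - 1 - v| <= 5 |v|^2 exp |v| under the integral sign. *)

Require Import Defs.
From mathcomp Require Import all_boot all_order all_algebra.
From mathcomp Require Import all_classical all_reals all_analysis.
From mathcomp Require Import measurable_realfun.
From mathcomp Require Import complex ring lra.
Import Order.TTheory GRing.Theory Num.Theory.
Import numFieldNormedType.Exports.
Import ComplexField.Normc.
Local Open Scope ring_scope.
Local Open Scope classical_set_scope.

Set Implicit Arguments.
Unset Strict Implicit.
Unset Printing Implicit Defensive.

(** * The Legendre gap *)

Definition leg_gap (R : realType) (b : R -> R) (X A : R) : Prop :=
  exists2 e : R, 0 < e &
    forall eta, exists l, eta * X - A / 2 + e <= eta * l - b l.

Lemma regionE (R : realType) (b : R -> R) (z w : R[i] * R[i]) :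
  region b z w <->
  leg_gap b ((complex.Re z.1 + complex.Re w.1) / 2)
    (complex.Im z.2 + complex.Im w.2).
Proof.
rewrite /region /=.
set X := (_ / 2).
have -> : complex.Im z.2 - b (complex.Re z.1) +
   (complex.Im w.2 - b (complex.Re w.1)) + b (complex.Re z.1) +
   b (complex.Re w.1) = complex.Im z.2 + complex.Im w.2 by ring.
set A := (_ + complex.Im w.2).
split=> [|[e e0 He]].
- rewrite /leg_gap; set B := legendre _ X => AB.
  have [e e0 Be] : exists2 e : R, 0 < e & (B <= (A / 2 - 2 * e)%:E)%E.
    move: AB; case: B => [r| |] //=.
    - rewrite lte_fin => h.
      by exists ((A / 2 - r) / 2); rewrite ?lee_fin; lra.
    - by rewrite mulry gtr0_sg ?mul1e.
    - by move=> _; exists 1; rewrite ?leNye ?ltr01.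
  exists e => // eta.
  have : ((eta * X - A / 2 + e)%:E < legendre (fun l => (b l)%:E) eta)%E.
    have : ((X * eta)%:E - legendre (fun l => (b l)%:E) eta <= B)%E.
      by apply: ereal_sup_ubound; exists eta.
    move=> /le_trans /(_ Be); case: legendre => [r| |] //=; last first.
      by rewrite ltry.
    rewrite -EFinB lee_fin lte_fin; lra.
  move=> /ereal_sup_gt [_ [l _ <-]]; rewrite -EFinB lte_fin => h.
  by exists l; apply: ltW.
- have : (legendre (legendre (fun l => (b l)%:E)) X <= (A / 2 - e)%:E)%E.
    apply: ge_ereal_sup => _ [eta _ <-].
    have [l hl] := He eta.
    have : ((eta * l - b l)%:E <= legendre (fun l => (b l)%:E) eta)%E.
      by rewrite EFinB; apply: ereal_sup_ubound; exists l.
    case: legendre => [r| |] //=; rewrite ?leNye //.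
    rewrite -EFinB !lee_fin; lra.
  case: legendre => [r| |] //=.
    rewrite !lee_fin lte_fin; lra.
  by rewrite mulrNy gtr0_sg ?mul1e ?ltr0n//= ltry.
Qed.

Lemma bq_bound_arg (R : realType) (p q M C l : R) : 0 <= M -> 0 <= C ->
  bq p q l <= M * `|l| + C ->
  `|l| <= 1 + (2 * `|p| + 4 * (`|q| + M + C)).
Proof.
move=> M0 C0; rewrite /bq => h; rewrite leNgt; apply/negP => hl.
have p0 := normr_ge0 p; have q0 := normr_ge0 q.
set S : R := _ + 4 * _ in hl.
have l1 : 1 < `|l| by apply: le_lt_trans hl; rewrite /S; lra.
have e2 : l ^+ 2 = `|l| ^+ 2 by rewrite real_normK ?num_real.
have e4 : l ^+ 4 = `|l| ^+ 4 by rewrite -[4%N]/(2*2)%N !exprM e2.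
have hp : - (`|p| * `|l| ^+ 2) <= p * l ^+ 2.
  by rewrite -e2 -mulNr ler_wpM2r ?sqr_ge0// lerNl -normrN ler_norm.
have hq : - (`|q| * `|l|) <= q * l by rewrite -normrM lerNl -normrN ler_norm.
rewrite e4 in h.
set y : R := `|l| in h hl l1 hp hq.
have y2 : y <= y ^+ 2 by rewrite expr2 ler_peMl //; lra.
have y3 : y ^+ 2 <= y ^+ 3 by rewrite [X in _ <= X]exprS ler_peMl ?sqr_ge0 //; lra.
have : S * y ^+ 3 < y ^+ 4.
  rewrite [X in _ < X]exprS ltr_pM2r ?exprn_gt0//; lra.
have : 2 * `|p| * y ^+ 2 <= 2 * `|p| * y ^+ 3 by rewrite ler_wpM2l//; lra.
have : 4 * `|q| * y <= 4 * `|q| * y ^+ 3 by rewrite ler_wpM2l//; lra.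
have : 4 * M * y <= 4 * M * y ^+ 3 by rewrite ler_wpM2l//; lra.
have : 4 * C * 1 <= 4 * C * y ^+ 3 by rewrite ler_wpM2l//; lra.
rewrite /S; lra.
Qed.

(* The maximisers may be kept in a compact set, and superlinearity of b turns
   the constant gap into one growing linearly in eta; this form is stable under
   small changes of X and A. *)
Lemma leg_gap_linear (R : realType) (p q X A : R) : leg_gap (bq p q) X A ->
  exists2 e : R, 0 < e & exists L : R, forall eta, exists2 l, `|l| <= L &
    eta * X - A / 2 + e * (1 + `|eta|) <= eta * l - bq p q l.
Proof.
move=> [e e0 He].
set b := bq p q; set K := `|X| + 1.
set B := `|b K| + `|b (- K)|; set M := 1 + 2 * B + `|A|.
have B0 : 0 <= B by rewrite addr_ge0.
have A0 := normr_ge0 A; have X0 := normr_ge0 X.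
have M0 : 1 <= M by rewrite /M; lra.
set C := M * `|X| + `|A|.
have C0 : 0 <= C by rewrite addr_ge0// mulr_ge0//; lra.
have hA := ler_norm A.
exists (Num.min (1 / 2) (e / (1 + M))).
  by rewrite lt_min; apply/andP; split; [lra | apply: divr_gt0; lra].
exists (K + (1 + (2 * `|p| + 4 * (`|q| + M + C)))) => eta.
have p0 := normr_ge0 p; have q0 := normr_ge0 q; have n0 := normr_ge0 eta.
have hX : eta * X <= `|eta| * `|X| by rewrite -normrM ler_norm.
have [hM|hM] := leP M `|eta|.
- have [s [hs hK]] : exists s, eta * s = K * `|eta| /\ (s = K \/ s = - K).
    have [h|h] := leP 0 eta.
    - by exists K; split; [rewrite ger0_norm// mulrC | left].
    - by exists (- K); split; [rewrite ltr0_norm//; ring | right].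
  exists s.
    have -> : `|s| = K.
      by case: hK => ->; rewrite ?normrN ger0_norm//; rewrite /K; lra.
    lra.
  have hb : b s <= B.
    rewrite /B; have := ler_norm (b K); have := ler_norm (b (- K)).
    by case: hK => -> ; have := normr_ge0 (b K); have := normr_ge0 (b (- K)); lra.
  rewrite hs /K.
  have : Num.min (1 / 2) (e / (1 + M)) * (1 + `|eta|) <= 1/2 * (1 + `|eta|).
    by apply: ler_wpM2r; [lra | rewrite ge_min lexx].
  have := ler_norm (- A); rewrite normrN.
  rewrite /M in hM; lra.
- have [l hl] := He eta.
  exists l.
    have : `|l| <= 1 + (2 * `|p| + 4 * (`|q| + M + C)).
      apply: bq_bound_arg => //; first lra.
      have : eta * l <= M * `|l|.
        apply: (le_trans (ler_norm _)); rewrite normrM ler_wpM2r//; exact: ltW.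
      have : - (eta * X) <= M * `|X|.
        apply: (le_trans (ler_norm _)); rewrite normrN normrM ler_wpM2r//; exact: ltW.
      rewrite -/b in hl *; rewrite /C; lra.
    rewrite /K; lra.
  apply: le_trans hl; rewrite lerD2l.
  have : Num.min (1 / 2) (e / (1 + M)) * (1 + `|eta|) <= e / (1 + M) * (1 + M).
    apply: ler_pM; rewrite ?ge_min ?lexx ?orbT//; try lra.
    rewrite le_min; apply/andP; split; [lra | apply: divr_ge0; lra].
  by move/le_trans; apply; rewrite divfK//; apply/eqP; lra.
Qed.

Lemma leg_gap_open (R : realType) (p q X A : R) : leg_gap (bq p q) X A ->
  exists2 d : R, 0 < d & forall X' A', `|X' - X| < d -> `|A' - A| < d ->
    leg_gap (bq p q) X' A'.
Proof.
move=> /leg_gap_linear[e e0 [L He]]; exists (e / 2); first lra.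
move=> X' A' hX hA; exists (e / 2); first lra.
move=> eta; have [l _ hl] := He eta; exists l.
have : eta * (X' - X) <= `|eta| * (e / 2).
  by apply: (le_trans (ler_norm _)); rewrite normrM ler_wpM2l// ltW.
have : A - A' <= e / 2.
  by apply: (le_trans (ler_norm _)); rewrite distrC ltW.
have := normr_ge0 eta; have : 0 <= e * `|eta| by rewrite mulr_ge0//; lra.
lra.
Qed.

Lemma leg_gap_convex (R : realType) (b : R -> R) (t l1 l2 X A : R) :
  0 <= t -> t <= 1 -> X = t * l1 + (1 - t) * l2 ->
  2 * (t * b l1 + (1 - t) * b l2) < A -> leg_gap b X A.
Proof.
move=> t0 t1 -> hA.
exists (A / 2 - (t * b l1 + (1 - t) * b l2)); first lra.
move=> eta.
have [h|h] := leP (eta * l2 - b l2) (eta * l1 - b l1).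
  exists l1; have : (1 - t) * (eta * l2 - b l2) <= (1 - t) * (eta * l1 - b l1).
    by rewrite ler_wpM2l//; lra.
  lra.
exists l2; have : t * (eta * l1 - b l1) <= t * (eta * l2 - b l2).
  by rewrite ler_wpM2l//; lra.
lra.
Qed.

(* b is the double well (x^2+p)^2/4 up to an affine function.  Between the
   wells, the midpoint is compared with the convex combination of the wells;
   outside, with itself. *)
Lemma leg_gap_off_Sigma (R : realType) (p q x r A : R) : p < 0 ->
  ~ (x = r /\ Num.sqrt (- p) < `|x| \/
     `|x| = Num.sqrt (- p) /\ `|r| = Num.sqrt (- p)) ->
  bq p q x + bq p q r <= A -> leg_gap (bq p q) ((x + r) / 2) A.
Proof.
move=> hp hS; set a := Num.sqrt (- p) in hS.
have a0 : 0 < a by rewrite sqrtr_gt0; lra.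
have ha : p = - a ^+ 2 by rewrite sqr_sqrtr; lra.
have norm_a y : y ^+ 2 - a ^+ 2 = 0 -> `|y| = a.
  move=> hy; apply/eqP; rewrite -(@eqrXn2 _ 2)// ?ltW//.
  by rewrite real_normK ?num_real//; apply/eqP; lra.
have bE y : bq p q y = (y ^+ 2 - a ^+ 2) ^+ 2 / 4 + q * y - a ^+ 4 / 4.
  by rewrite /bq ha; field.
set X := (x + r) / 2 => hA.
have [hX|hX] := leP `|X| a.
- have [h1 h2] : - a <= X /\ X <= a by apply/andP; rewrite -ler_norml.
  apply: (@leg_gap_convex _ _ ((X + a) / (2 * a)) a (- a)).
  + by apply: divr_ge0; lra.
  + by rewrite ler_pdivrMr; lra.
  + by field; apply/eqP; lra.
  + apply: lt_le_trans hA; rewrite !bE.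
    have -> : (- a) ^+ 2 = a ^+ 2 by rewrite sqrrN.
    have -> : (a ^+ 2 - a ^+ 2) ^+ 2 = 0 by rewrite subrr expr0n.
    have -> : 2 * ((X + a) / (2 * a) * (0 / 4 + q * a - a ^+ 4 / 4) +
       (1 - (X + a) / (2 * a)) * (0 / 4 + q * - a - a ^+ 4 / 4)) =
      q * (2 * X) - a ^+ 4 / 2 by field; apply/eqP; lra.
    have -> : 2 * X = x + r by rewrite /X; field.
    have g1 := sqr_ge0 (x ^+ 2 - a ^+ 2); have g2 := sqr_ge0 (r ^+ 2 - a ^+ 2).
    suff : 0 < (x ^+ 2 - a ^+ 2) ^+ 2 + (r ^+ 2 - a ^+ 2) ^+ 2 by lra.
    rewrite lt_def addr_ge0// andbT paddr_eq0// !sqrf_eq0; apply/negP.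
    move=> /andP[/eqP e1 /eqP e2]; apply: hS; right; split; exact: norm_a.
- have hxr : x != r.
    apply/eqP => xr; apply: hS; left; split => //.
    by have <- : X = x by rewrite /X -xr; field.
  apply: (@leg_gap_convex _ _ 1 X 0) => //; [ring |].
  apply: lt_le_trans hA; rewrite !bE.
  set d := (x - r) / 2.
  have d0 : 0 < d ^+ 2.
    by rewrite exprn_even_gt0//= mulf_neq0 ?subr_eq0 ?invr_eq0.
  have -> : x = X + d by rewrite /X /d; field.
  have -> : r = X - d by rewrite /X /d; field.
  have hX2 : a ^+ 2 < X ^+ 2.
    by rewrite -[X in _ < X]real_normK ?num_real// ltrXn2r ?nnegrE// ltW.
  have : 0 < d ^+ 2 * (X ^+ 2 - a ^+ 2) by rewrite mulr_gt0//; lra.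
  have : 0 < d ^+ 2 * d ^+ 2 by rewrite mulr_gt0.
  have : 0 <= d ^+ 2 * X ^+ 2 by rewrite mulr_ge0 ?sqr_ge0.
  nra.
Qed.

(** * The normalising integral and the dominating function *)

Lemma measurable_bq (R : realType) (p q : R) : measurable_fun setT (bq p q).
Proof.
apply: measurable_funD; last exact: measurable_funM.
by apply: measurable_funD; do ?apply: measurable_funM => //;
  exact: measurable_funX.
Qed.

Lemma Nfun_ge0 (R : realType) (b : R -> R) (eta tau : R) : 0 <= Nfun b eta tau.
Proof. by apply: Rintegral_ge0 => l _; exact: expR_ge0. Qed.

(* If the integral diverges, Rintegral returns 0 and so does its inverse. *)
Lemma Rintegral_inv_le (R : realType) (f : R -> R) (u d v : R) :
  measurable_fun setT f -> (forall x, 0 <= f x) -> 0 < d -> 0 < v ->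
  (forall x, u <= x -> x <= u + d -> v <= f x) ->
  (Rintegral (@lebesgue_measure R) [set: R] f)^-1 <= (v * d)^-1.
Proof.
move=> mf f0 d0 v0 hv; rewrite /Rintegral.
have vd0 : 0 < v * d by rewrite mulr_gt0.
have : ((v * d)%:E <= \int[@lebesgue_measure R]_x (f x)%:E)%E.
  apply: (@le_trans _ _ (\int[@lebesgue_measure R]_(x in `[u, (u + d)%R]) (f x)%:E)%E).
    apply: (@le_trans _ _ (\int[@lebesgue_measure R]_(x in `[u, (u + d)%R]) v%:E)%E).
      rewrite integral_cst//= lebesgue_measure_itv/= lte_fin ltrDl d0.
      by rewrite -EFinD -EFinM addrAC subrr add0r.
    apply: ge0_le_integral => //=.
    - by move=> x _; rewrite lee_fin ltW.
    - by apply/measurable_EFinP; exact: measurable_funTS.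
    - by move=> x; rewrite in_itv/= => /andP[h1 h2]; rewrite lee_fin hv.
  apply: ge0_subset_integral => //=; first exact/measurable_EFinP.
  by move=> x _; rewrite lee_fin.
set I := integral _ _ _; case: I => [r| |] //=.
  by rewrite lee_fin => h; rewrite lef_pV2// posrE// (lt_le_trans vd0).
by move=> _; rewrite invr0 invr_ge0 ltW.
Qed.

(* Integrating over one side of l only, on which the linear term of the Taylor
   expansion at l is nonnegative, l need not maximise the exponent. *)
Lemma Nfun_inv_le (R : realType) (p q L : R) : 0 <= L ->
  exists2 C : R, 0 <= C & forall eta tau l : R, 0 < tau -> `|l| <= L ->
    (Nfun (bq p q) eta tau)^-1 <=
      C * (1 + tau) * expR (- (2 * tau * (eta * l - bq p q l))).
Proof.
move=> L0; set K : R := 3 * L ^+ 2 + `|p| + 2 * L + 1.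
exists (expR K); first exact: expR_ge0.
move=> eta tau l t0 hl.
set d : R := (1 + tau)^-1.
have d0 : 0 < d by rewrite invr_gt0; lra.
have d1 : tau * d ^+ 2 <= 1.
  rewrite /d exprVn ler_pdivrMr ?exprn_gt0//; last lra.
  have := sqr_ge0 tau; nra.
set v := expR (2 * tau * (eta * l - bq p q l) - K).
have [u hu] : exists u : R, forall x, u <= x -> x <= u + d ->
    `|x - l| <= d /\ 0 <= (eta - (l ^+ 3 + p * l + q)) * (x - l).
  have [h|h] := leP 0 (eta - (l ^+ 3 + p * l + q)).
  - exists l => x h1 h2; split; last by rewrite mulr_ge0//; lra.
    by rewrite ger0_norm; lra.
  - exists (l - d) => x h1 h2; split; last by rewrite nmulr_rge0//; lra.
    by rewrite ler0_norm; lra.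
have -> : expR K * (1 + tau) * expR (- (2 * tau * (eta * l - bq p q l))) = (v * d)^-1.
  by rewrite invfM /d invrK /v -expRN opprB [expR (K - _)]expRD mulrAC.
apply: (@Rintegral_inv_le _ _ u) => //.
- apply: measurableT_comp => //.
  apply: measurable_funM => //; apply: measurable_funB; last exact: measurable_bq.
  exact: measurable_funM.
- exact: expR_gt0.
- move=> x h1 h2; rewrite ler_expR; have [hs hlin] := hu x h1 h2.
  set s : R := x - l in hs hlin.
  have -> : x = l + s by rewrite /s; ring.
  have hE : eta * (l + s) - bq p q (l + s) = eta * l - bq p q l +
     (eta - (l ^+ 3 + p * l + q)) * s - s ^+ 2 * ((3 * l ^+ 2 + p) / 2 + l * s + s ^+ 2 / 4).
    by rewrite /bq; field.
  have s2 : s ^+ 2 <= d ^+ 2.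
    by rewrite -[s ^+ 2]real_normK ?num_real// lerXn2r ?nnegrE// ltW.
  have dle1 : d <= 1 by rewrite invf_le1; lra.
  have d2le1 : d ^+ 2 <= 1 by rewrite exprn_ile1// ltW.
  have l2 : l ^+ 2 <= L ^+ 2.
    by rewrite -[l ^+ 2]real_normK ?num_real// lerXn2r ?nnegrE.
  have ls : l * s <= L.
    apply: (le_trans (ler_norm _)); rewrite normrM -[leRHS]mulr1.
    by rewrite ler_pM// (le_trans hs).
  set W : R := _ / 2 + l * s + _ in hE.
  have hW : W <= K / 2.
    have := ler_norm p; rewrite /W /K; lra.
  have K0 : 0 <= K / 2.
    have := normr_ge0 p; have := sqr_ge0 L; rewrite /K; lra.
  have : tau * (s ^+ 2 * W) <= K / 2.
    apply: (@le_trans _ _ (tau * s ^+ 2 * (K / 2))).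
      by rewrite mulrA ler_wpM2l// mulr_ge0 ?sqr_ge0// ltW.
    rewrite -[leRHS]mul1r ler_wpM2r//; apply: le_trans d1.
    by rewrite ler_wpM2l// ltW.
  have : 0 <= tau * ((eta - (l ^+ 3 + p * l + q)) * s) by rewrite mulr_ge0// ltW.
  rewrite hE; lra.
Qed.

Lemma measurable_Nfun (R : realType) (p q : R) :
  measurable_fun [set: R * R] (fun et => Nfun (bq p q) et.1 et.2).
Proof.
pose f (x : (R * R) * R) :=
  (expR (2 * x.1.2 * (x.1.1 * x.2 - bq p q x.2)))%:E.
have mf : measurable_fun setT f.
  apply/measurable_EFinP; apply: measurableT_comp => //.
  have m11 : measurable_fun setT (fun x : (R * R) * R => x.1.1).
    exact: measurableT_comp.
  have m12 : measurable_fun setT (fun x : (R * R) * R => x.1.2).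
    exact: measurableT_comp.
  apply: measurable_funM; first exact: measurable_funM.
  apply: measurable_funB; first exact: measurable_funM.
  exact: (measurableT_comp (@measurable_bq _ p q)).
have f0 x : (0 <= f x)%E by rewrite lee_fin expR_ge0.
have h := @measurable_fun_fubini_tonelli_F _ _ _ _ R (@lebesgue_measure R) f mf f0.
exact: (measurableT_comp _ h).
Qed.

Lemma integral_expR_norm (R : realType) (a : R) : 0 < a ->
  (\int[@lebesgue_measure R]_x (a * expR (- (a * `|x|)))%:E = 2%:E)%E.
Proof.
move=> a0.
rewrite ge0_symfun_integralT.
- rewrite -[RHS]mule1; congr (_ * _)%E.
  rewrite -(@integral_exponential_pdf R a a0).
  rewrite integral_mkcond; apply: eq_integral => x _.
  rewrite /exponential_pdf !patchE set_itvE/=.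
  by case: ifPn => //; rewrite inE /= => x0; rewrite ger0_norm// mulNr.
- by move=> x; rewrite mulr_ge0 ?expR_ge0 ?ltW.
- move=> x; apply: cvgMr; apply: continuous_comp; last exact: continuous_expR.
  by apply: cvgN; apply: cvgMr; exact: norm_continuous.
- by move=> x /=; rewrite normrN.
Qed.

(* Stated on measurableTypeR, on which lebesgue_measure lives: the Borel
   structure carried by R itself is convertible but has another display. *)
Lemma measurable_tau_pos (R : realType) :
  @measurable _ (measurableTypeR R * measurableTypeR R)%type (@tau_pos R).
Proof.
have -> : @tau_pos R = setT `&` (fun x => x.2) @^-1` `]0, +oo[%classic.
  by apply/seteqP; split=> x; rewrite /tau_pos/= in_itv/= andbT// => -[].
by apply: measurable_snd.
Qed.

Definition kern_bound (R : realType) (d : R) (et : R * R) : R :=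
  et.2 * expR (- (d * (et.2 * (1 + `|et.1|)))).

Lemma measurable_kern_bound (R : realType) (d : R) :
  measurable_fun setT (@kern_bound R d).
Proof.
apply: measurable_funM => //; apply: measurableT_comp => //.
apply: measurableT_comp => //; apply: measurable_funM => //.
apply: measurable_funM => //; apply: measurable_funD => //.
exact: measurableT_comp.
Qed.

Lemma integrable_kern_bound (R : realType) (d : R) : 0 < d ->
  (@mu2 R).-integrable (@tau_pos R) (EFin \o kern_bound d).
Proof.
move=> d0; apply/integrableP; split.
  by apply/measurable_EFinP; apply: measurable_funTS; exact: measurable_kern_bound.
pose g := (kern_bound d \_ (@tau_pos R)) : R * R -> R.
have g0 x : 0 <= g x.
  rewrite /g patchE; case: ifPn => //; rewrite inE => x0.
  by rewrite mulr_ge0 ?expR_ge0 ?ltW.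
have mg : measurable_fun setT (EFin \o g).
  apply/measurable_EFinP; apply/measurable_restrict => //.
    exact: measurable_tau_pos.
  by apply: measurable_funTS; exact: measurable_kern_bound.
have -> : (\int[@mu2 R]_(x in @tau_pos R) `|(EFin \o kern_bound d) x| =
    \int[@mu2 R]_x (EFin \o g) x)%E.
  rewrite integral_mkcond; apply: eq_integral => x _.
  rewrite /g /= !patchE; case: ifPn => //; rewrite inE => x0.
  by rewrite ger0_norm// mulr_ge0 ?expR_ge0 ?ltW.
rewrite /mu2 fubini_tonelli2//.
apply: (@le_lt_trans _ _
   ((2 / d ^+ 2)%:E * \int[@lebesgue_measure R]_y (exponential_pdf d y)%:E)%E);
  last by rewrite integral_exponential_pdf// mule1 ltry.
have c0 : 0 <= 2 / d ^+ 2 by rewrite divr_ge0 ?sqr_ge0.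
have mpdf : measurable_fun setT (EFin \o exponential_pdf d).
  by apply/measurable_EFinP; exact: measurable_exponential_pdf.
have pdf0 x : (0 <= (exponential_pdf d x)%:E)%E.
  by rewrite lee_fin exponential_pdf_ge0 ?ltW.
rewrite -ge0_integralZl ?lee_fin//.
apply: ge0_le_integral => //.
- by move=> y _; apply: integral_ge0 => x _; rewrite lee_fin.
- by apply: measurable_fun_fubini_tonelli_G => // x; rewrite lee_fin.
- exact: measurable_funeM.
move=> y _; rewrite /fubini_G.
have [y0|y0] := leP y 0.
  rewrite integral0_eq; first by apply: mule_ge0; [rewrite lee_fin | exact: pdf0].
  move=> x _; rewrite /g /= patchE; case: ifPn => //.
  by rewrite inE /tau_pos/= ltNge y0.
have dy : 0 < d * y by rewrite mulr_gt0.
have -> : (fun x => (EFin \o g) (x, y)) =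
    (fun x => (expR (- (d * y)) / d)%:E * (d * y * expR (- (d * y * `|x|)))%:E)%E.
  apply/funext => x; rewrite /g /= patchE mem_set// /kern_bound/=.
  rewrite -EFinM; congr EFin.
  have -> : - (d * (y * (1 + `|x|))) = - (d * y) - (d * y * `|x|) by ring.
  by rewrite expRD; field; rewrite gt_eqF.
rewrite ge0_integralZl//; last 3 first.
- apply/measurable_EFinP; apply: measurable_funM => //.
  apply: measurableT_comp => //; apply: measurableT_comp => //.
  apply: measurable_funM => //.
- by move=> x _; rewrite lee_fin mulr_ge0 ?expR_ge0// ltW.
- by rewrite lee_fin divr_ge0 ?expR_ge0// ltW.
rewrite integral_expR_norm//= exponential_pdfE; last exact: ltW.
rewrite -!EFinM lee_fin.
rewrite le_eqVlt; apply/orP; left; apply/eqP.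
by rewrite mulNr; field; rewrite gt_eqF.
Qed.

(** * The complex exponential *)

Lemma mean_value_bound (R : realType) (f df : R -> R) (M y : R) :
  (forall x, is_derive x (1 : R) f (df x)) ->
  (forall x, `|x| <= `|y| -> `|df x| <= M) -> `|f y - f 0| <= M * `|y|.
Proof.
move=> hd hM.
have cf : continuous f.
  move=> x; apply: differentiable_continuous; apply/derivable1_diffP.
  exact: (@ex_derive _ _ _ _ _ _ _ (hd x)).
have [y0|y0] := leP 0 y.
- have [c] := @MVT_segment R f df 0 y y0 (fun x _ => hd x) (continuous_subspaceT cf).
  rewrite in_itv/= => /andP[c0 cy] ->; rewrite subr0 normrM ler_wpM2r// hM//.
  by rewrite !ger0_norm.
- have [c] := @MVT_segment R f df y 0 (ltW y0) (fun x _ => hd x) (continuous_subspaceT cf).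
  rewrite in_itv/= => /andP[c0 cy] h; rewrite distrC h sub0r normrM normrN ler_wpM2r// hM//.
  by rewrite !ler0_norm ?lerN2// ltW.
Qed.

Lemma normr_sin_le (R : realType) (y : R) : `|sin y| <= `|y|.
Proof.
have := @mean_value_bound R sin cos 1 y _ (fun x _ => cos_max x).
by rewrite sin0 subr0 mul1r; apply.
Qed.

Lemma cos_dist_le (R : realType) (y : R) : `|cos y - 1| <= `|y| ^+ 2.
Proof.
have := @mean_value_bound R cos (fun x => - sin x) `|y| y.
rewrite cos0 -expr2; apply=> x hx.
by rewrite normrN (le_trans (normr_sin_le _)).
Qed.

Lemma sin_dist_le (R : realType) (y : R) : `|sin y - y| <= `|y| ^+ 2.
Proof.
have := @mean_value_bound R (fun x => sin x - x) (fun x => cos x - 1) `|y| y.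
rewrite sin0 !subr0 -expr2; apply=> x hx.
have := @mean_value_bound R cos (fun x => - sin x) 1 x.
rewrite cos0 mul1r => h; apply: le_trans hx; apply: h => z _.
by rewrite normrN sin_max.
Qed.

Lemma expR_dist_le (R : realType) (x : R) : `|expR x - 1| <= `|x| * expR `|x|.
Proof.
have h1 := expR_ge1Dx x; have h2 := expR_ge1Dx (- x).
have [x0|x0] := leP 0 x.
- rewrite (ger0_norm x0) ger0_norm; last by have := expR_ge1Dx x; lra.
  have := ler_wpM2l (expR_ge0 x) h2.
  by rewrite expRN mulfV ?gt_eqF ?expR_gt0//; lra.
- rewrite (ltr0_norm x0) ler0_norm; last by rewrite subr_le0 expR_le1 ltW.
  apply: (@le_trans _ _ (- x)); first lra.
  by rewrite ler_peMr; lra.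
Qed.

Lemma expR_rem (R : realType) (x : R) :
  0 <= expR x - 1 - x <= `|x| ^+ 2 * expR `|x|.
Proof.
have h1 := expR_ge1Dx x; apply/andP; split; first lra.
have h2 : expR x - 1 <= x * expR x.
  have := ler_wpM2l (expR_ge0 x) (expR_ge1Dx (- x)).
  by rewrite expRN mulfV ?gt_eqF ?expR_gt0//; lra.
have [x0|x0] := leP 0 x.
- rewrite ger0_norm// expr2 -mulrA.
  apply: (@le_trans _ _ (x * (expR x - 1))); first lra.
  by rewrite ler_wpM2l//; lra.
- rewrite ltr0_norm//.
  have : 1 <= expR (- x) by have := expR_ge1Dx (- x); lra.
  have : x * (expR x - 1) <= x * x by apply: ler_wnM2l; lra.
  have := sqr_ge0 x; rewrite sqrrN; nra.
Qed.

Section Complex.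
Variable R : realType.
Implicit Types (x y z v : R[i]).

Lemma normc_ge0 v : 0 <= normc v.
Proof. by case: v => a b; exact: sqrtr_ge0. Qed.

Lemma normc_real (a : R) : normc (a%:C)%C = `|a|.
Proof. by rewrite /= expr0n addr0 sqrtr_sqr. Qed.

Lemma normc_i : normc ('i%C : R[i]) = 1.
Proof. by rewrite /= expr0n add0r expr1n sqrtr1. Qed.

Lemma normcN v : normc (- v) = normc v.
Proof. by case: v => a b /=; rewrite !sqrrN. Qed.

Lemma Re_le_normc v : `|complex.Re v| <= normc v.
Proof.
by case: v => a b /=; rewrite -sqrtr_sqr ler_wsqrtr// lerDl sqr_ge0.
Qed.

Lemma Im_le_normc v : `|complex.Im v| <= normc v.
Proof.
by case: v => a b /=; rewrite -sqrtr_sqr ler_wsqrtr// lerDr sqr_ge0.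
Qed.

Lemma normc_le_ReIm v : normc v <= `|complex.Re v| + `|complex.Im v|.
Proof.
case: v => a b /=; rewrite -(@ler_pXn2r _ 2) ?nnegrE ?addr_ge0 ?sqrtr_ge0//.
rewrite sqr_sqrtr ?addr_ge0 ?sqr_ge0// sqrrD !real_normK ?num_real//.
have : 0 <= `|a| * `|b| by rewrite mulr_ge0.
lra.
Qed.

Lemma cexpD x y : cexp (x + y) = cexp x * cexp y.
Proof.
case: x y => [a b] [c d]; rewrite /cexp /= expRD cosD sinD.
by apply/eqP; rewrite eq_complex /=; apply/andP; split; apply/eqP; ring.
Qed.

Lemma normc_cexp v : normc (cexp v) = expR (complex.Re v).
Proof.
case: v => a b /=; rewrite !exprMn -mulrDr cos2Dsin2 mulr1 sqrtr_sqr.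
by rewrite ger0_norm// expR_ge0.
Qed.

Lemma cexp_rem v :
  normc (cexp v - 1 - v) <= 5 * (normc v ^+ 2 * expR (normc v)).
Proof.
apply: (le_trans (normc_le_ReIm _)).
have hx := Re_le_normc v; have hy := Im_le_normc v.
case: v hx hy => x y; set r := normc _ => /= hx hy.
have r0 : 0 <= r by exact: normc_ge0.
have hE : expR x <= expR r by rewrite ler_expR (le_trans (ler_norm _)).
have hE' : expR `|x| <= expR r by rewrite ler_expR.
have E1 : 1 <= expR r by have := expR_ge1Dx r; lra.
have E0 := expR_ge0 x.
have x2 : `|x| ^+ 2 <= r ^+ 2 by rewrite lerXn2r ?nnegrE.
have y2 : `|y| ^+ 2 <= r ^+ 2 by rewrite lerXn2r ?nnegrE.
have r2 : 0 <= r ^+ 2 by rewrite sqr_ge0.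
have [ex0 ex1] := andP (expR_rem x).
have hex : `|expR x - 1 - x| <= r ^+ 2 * expR r.
  by rewrite ger0_norm// (le_trans ex1)// ler_pM ?sqr_ge0 ?expR_ge0.
have hc : `|expR x * (cos y - 1)| <= r ^+ 2 * expR r.
  rewrite normrM [in leLHS]ger0_norm// mulrC ler_pM//.
  exact: le_trans (cos_dist_le _) y2.
have hs : `|(expR x - 1) * sin y| <= 2 * (r ^+ 2 * expR r).
  have h2 : `|expR x - 1| <= r * expR r.
    exact: le_trans (expR_dist_le x) (ler_pM _ _ hx hE').
  rewrite normrM; apply: (@le_trans _ _ (r * expR r * r)).
    by rewrite ler_pM// (le_trans (normr_sin_le _)).
  have : 0 <= r ^+ 2 * expR r by rewrite mulr_ge0 ?expR_ge0.
  lra.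
have hs' : `|sin y - y| <= r ^+ 2 * expR r.
  rewrite (le_trans (sin_dist_le _))// (le_trans y2)//.
  by rewrite ler_peMr.
have -> : expR x * cos y + - 1 + - x = (expR x - 1 - x) + expR x * (cos y - 1) by ring.
have -> : expR x * sin y + - 0 + - y = (expR x - 1) * sin y + (sin y - y) by ring.
have := ler_normD (expR x - 1 - x) (expR x * (cos y - 1)).
have := ler_normD ((expR x - 1) * sin y) (sin y - y).
lra.
Qed.

End Complex.

Lemma powr_le_expR (R : realType) (d : R) (n : nat) : 0 < d ->
  exists2 C : R, 0 <= C & forall y, 0 <= y -> y ^+ n <= C * expR (d * y).
Proof.
move=> d0; exists (n`!%:R / d ^+ n); first by rewrite divr_ge0 ?ler0n ?exprn_ge0 ?ltW.
move=> y y0.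
have : (d * y) ^+ n <= n`!%:R * expR (d * y).
  have dy : 0 <= d * y by rewrite mulr_ge0// ltW.
  case: n => [|n].
    by rewrite expr0 fact0 mul1r; have := expR_ge1Dx (d * y); lra.
  rewrite [leRHS]mulrC -ler_pdivrMr ?ltr0n ?fact_gt0//.
  by have := expR_ge1Dxn n dy; lra.
by rewrite exprMn mulrAC ler_pdivlMr ?exprn_gt0// mulrC.
Qed.

Lemma is_derive_quadratic (R : realType) (f : (R[i])^o -> (R[i])^o) (x df : R[i])
    (K d : R) : 0 < d ->
  (forall u : R[i], normc u <= d ->
     normc (f (x + u) - f x - u * df) <= K * normc u ^+ 2) ->
  is_derive (x : (R[i])^o) (1 : (R[i])^o) f (df : (R[i])^o).
Proof.
move=> d0 H.
suff cv : (fun h : (R[i])^o => h^-1 *: ((f \o shift (x : (R[i])^o)) (h *: 1) - f x)) @ 0^'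
   --> (df : (R[i])^o).
  apply: DeriveDef; first by apply/cvg_ex; exists (df : (R[i])^o).
  exact: cvg_lim.
apply/cvgrPdist_lt => e; case: e => e e'; rewrite ltcE/= => /andP[/eqP -> e0].
set dl := Num.min d (e / (`|K| + 1)).
have dl0 : 0 < dl.
  by rewrite lt_min d0/= divr_gt0// ltr_wpDl.
near=> h.
have h0 : h != 0 by near: h; exact: nbhs_dnbhs_neq.
have : `|h| < (dl%:C)%C by near: h; apply: dnbhs0_lt; rewrite ltcR.
rewrite [`|h|]/((normc h)%:C)%C ltcR => hd.
have -> : (df : (R[i])^o) - h^-1 *: ((f \o shift (x : (R[i])^o)) (h *: 1) - f x) =
   - (h^-1 * (f (x + h) - f x - h * df)).
  rewrite /= [h *: _]mulr1 [h + x]addrC mulrBr mulrA mulVf// mul1r opprB.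
  by [].
rewrite normrN.
rewrite -[`|_|]/((normc (h^-1 * (f (x + h) - f x - h * df)))%:C)%C.
rewrite ltcR normcM normcV.
have n0 : 0 < normc h.
  rewrite lt_def normc_ge0 andbT; apply: contra h0 => /eqP hh.
  by apply/eqP; exact: eq0_normc.
rewrite ltr_pdivrMl//.
have [hd1 hd2] : normc h < d /\ normc h < e / (`|K| + 1).
  by move: hd; rewrite lt_min => /andP.
apply: (le_lt_trans (H h (ltW hd1))).
rewrite expr2 mulrCA ltr_pM2l//.
move: hd2; rewrite ltr_pdivlMr; last by rewrite ltr_wpDl.
apply: le_lt_trans; rewrite mulrC ler_wpM2l ?normc_ge0//.
by have := ler_norm K; lra.
Unshelve. all: by end_near.
Qed.

(** * Complex-valued integrals *)

Section ComplexIntegral.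
Variable R : realType.
Implicit Types (f g k : R * R -> R[i]) (u : R[i]).

Definition cmeasurable f : Prop :=
  measurable_fun (@tau_pos R) (fun et => complex.Re (f et)) /\
  measurable_fun (@tau_pos R) (fun et => complex.Im (f et)).

Definition dominated (d : R) f : Prop :=
  exists2 C : R, 0 <= C &
    forall et, tau_pos et -> normc (f et) <= C * kern_bound d et.

Lemma cmeasurableM f g :
  cmeasurable f -> cmeasurable g -> cmeasurable (fun et => f et * g et).
Proof.
move=> [f1 f2] [g1 g2]; split.
- have -> : (fun et => complex.Re (f et * g et)) = (fun et =>
      complex.Re (f et) * complex.Re (g et) - complex.Im (f et) * complex.Im (g et)).
    by apply/funext => et; case: (f et) (g et) => a b [].
  by apply: measurable_funB; apply: measurable_funM.
- have -> : (fun et => complex.Im (f et * g et)) = (fun et =>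
      complex.Re (f et) * complex.Im (g et) + complex.Im (f et) * complex.Re (g et)).
    by apply/funext => et; case: (f et) (g et) => a b [].
  by apply: measurable_funD; apply: measurable_funM.
Qed.

Lemma cmeasurableD f g :
  cmeasurable f -> cmeasurable g -> cmeasurable (fun et => f et + g et).
Proof.
move=> [f1 f2] [g1 g2]; split.
- have -> : (fun et => complex.Re (f et + g et)) =
      (fun et => complex.Re (f et) + complex.Re (g et)).
    by apply/funext => et; case: (f et) (g et) => a b [].
  exact: measurable_funD.
- have -> : (fun et => complex.Im (f et + g et)) =
      (fun et => complex.Im (f et) + complex.Im (g et)).
    by apply/funext => et; case: (f et) (g et) => a b [].
  exact: measurable_funD.
Qed.

Lemma cmeasurableB f g :
  cmeasurable f -> cmeasurable g -> cmeasurable (fun et => f et - g et).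
Proof.
move=> [f1 f2] [g1 g2]; split.
- have -> : (fun et => complex.Re (f et - g et)) =
      (fun et => complex.Re (f et) - complex.Re (g et)).
    by apply/funext => et; case: (f et) (g et) => a b [].
  exact: measurable_funB.
- have -> : (fun et => complex.Im (f et - g et)) =
      (fun et => complex.Im (f et) - complex.Im (g et)).
    by apply/funext => et; case: (f et) (g et) => a b [].
  exact: measurable_funB.
Qed.

Lemma cmeasurable_cst u : cmeasurable (fun=> u).
Proof. by split; exact: measurable_cst. Qed.

Lemma cmeasurable_real (h : R * R -> R) : measurable_fun (@tau_pos R) h ->
  cmeasurable (fun et => (h et)%:C%C).
Proof. by move=> mh; split => //=; exact: measurable_cst. Qed.

Lemma cmeasurable_cexp f : cmeasurable f -> cmeasurable (fun et => cexp (f et)).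
Proof.
move=> [f1 f2]; split => /=.
- apply: measurable_funM; first exact: measurableT_comp.
  apply: (measurableT_comp (f := @cos R)) => //.
  apply: continuous_measurable_fun; exact: continuous_cos.
- apply: measurable_funM; first exact: measurableT_comp.
  apply: (measurableT_comp (f := @sin R)) => //.
  apply: continuous_measurable_fun; exact: continuous_sin.
Qed.

Definition cintegrable f : Prop :=
  (@mu2 R).-integrable (@tau_pos R) (fun et => (complex.Re (f et))%:E) /\
  (@mu2 R).-integrable (@tau_pos R) (fun et => (complex.Im (f et))%:E).

Lemma kern_bound_ge0 (d : R) et : tau_pos et -> 0 <= kern_bound d et.
Proof. by move=> h; rewrite mulr_ge0 ?expR_ge0// ltW. Qed.

Lemma integrableZ_kern_bound (C d : R) : 0 < d ->
  (@mu2 R).-integrable (@tau_pos R) (fun et => (C * kern_bound d et)%:E).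
Proof.
move=> d0.
exact: (integrableZl (@measurable_tau_pos R) C (integrable_kern_bound d0)).
Qed.

Lemma dominated_integrable (d C : R) (h : R * R -> R) : 0 < d ->
  measurable_fun (@tau_pos R) h ->
  (forall et, tau_pos et -> `|h et| <= C * kern_bound d et) ->
  (@mu2 R).-integrable (@tau_pos R) (fun et => (h et)%:E).
Proof.
move=> d0 mh hC; apply: le_integrable (integrableZ_kern_bound C d0).
- exact: measurable_tau_pos.
- exact/measurable_EFinP.
- by move=> et t0 /=; rewrite lee_fin (le_trans (hC _ t0))// ler_norm.
Qed.

Lemma dominated_cintegrable (d : R) f : 0 < d ->
  cmeasurable f -> dominated d f -> cintegrable f.
Proof.
move=> d0 [m1 m2] [C C0 hC]; split; apply: (dominated_integrable d0 _ (C := C)) => //.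
- by move=> et t0; apply: le_trans (hC _ t0); exact: Re_le_normc.
- by move=> et t0; apply: le_trans (hC _ t0); exact: Im_le_normc.
Qed.

Lemma dominated_abs_conv (d : R) f : 0 < d ->
  cmeasurable f -> dominated d f -> abs_conv f.
Proof.
move=> d0 mf df; have [m1 m2] := mf; split=> //; split=> //.
have [C C0 hC] := df.
have mn : measurable_fun (@tau_pos R) (fun et => normc (f et)).
  have -> : (fun et => normc (f et)) =
      (fun et => Num.sqrt (complex.Re (f et) ^+ 2 + complex.Im (f et) ^+ 2)).
    by apply/funext => et; case: (f et).
  apply: measurableT_comp => //.
    apply: continuous_measurable_fun; exact: sqrt_continuous.
  by apply: measurable_funD; exact: measurable_funX.
have /integrableP[_] := integrableZ_kern_bound C d0.
apply: le_lt_trans; apply: ge0_le_integral => //.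
- exact: measurable_tau_pos.
- by move=> et _; rewrite lee_fin normc_ge0.
- exact/measurable_EFinP.
- apply: measurableT_comp => //; apply/measurable_EFinP.
  apply: measurable_funM => //; apply: measurable_funTS.
  exact: measurable_kern_bound.
- by move=> et t0; rewrite lee_fin (le_trans (hC _ t0))// ler_norm.
Qed.

Lemma cintegrableB f g : cintegrable f -> cintegrable g ->
  cintegrable (fun et => f et - g et).
Proof.
have mt := @measurable_tau_pos R.
move=> [f1 f2] [g1 g2]; split.
- have -> : (fun et => (complex.Re (f et - g et))%:E) =
      ((fun et => (complex.Re (f et))%:E) \- (fun et => (complex.Re (g et))%:E))%E.
    by apply/funext => et /=; case: (f et) (g et) => a b [].
  exact: integrableB.
- have -> : (fun et => (complex.Im (f et - g et))%:E) =
      ((fun et => (complex.Im (f et))%:E) \- (fun et => (complex.Im (g et))%:E))%E.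
    by apply/funext => et /=; case: (f et) (g et) => a b [].
  exact: integrableB.
Qed.

Lemma CintB f g : cintegrable f -> cintegrable g ->
  Cint (fun et => f et - g et) = Cint f - Cint g.
Proof.
move=> [f1 f2] [g1 g2]; rewrite /Cint; apply/eqP; rewrite eq_complex /=.
have mt := @measurable_tau_pos R.
apply/andP; split; apply/eqP; rewrite -RintegralB//; apply: eq_Rintegral => et _;
  by case: (f et) (g et) => a b [].
Qed.

Lemma CintZ u f : cintegrable f -> Cint (fun et => u * f et) = u * Cint f.
Proof.
move=> [f1 f2]; rewrite /Cint; apply/eqP; case: u => a b; rewrite eq_complex /=.
have mt := @measurable_tau_pos R.
have i1 c : (@mu2 R).-integrable (@tau_pos R) (fun et => (c * complex.Re (f et))%:E).
  exact: (integrableZl mt c f1).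
have i2 c : (@mu2 R).-integrable (@tau_pos R) (fun et => (c * complex.Im (f et))%:E).
  exact: (integrableZl mt c f2).
apply/andP; split; apply/eqP; rewrite -!RintegralZl// -?RintegralB -?RintegralD//;
  try exact: i1; try exact: i2; apply: eq_Rintegral => et _; by case: (f et).
Qed.

Lemma normc_Cint_le (d K : R) f : 0 < d -> cmeasurable f ->
  (forall et, tau_pos et -> normc (f et) <= K * kern_bound d et) ->
  normc (Cint f) <= K * (2 * Rintegral (@mu2 R) (@tau_pos R) (kern_bound d)).
Proof.
move=> d0 [m1 m2] hK.
have I_le (h : R * R -> R) : measurable_fun (@tau_pos R) h ->
    (forall et, tau_pos et -> `|h et| <= K * kern_bound d et) ->
    `|Rintegral (@mu2 R) (@tau_pos R) h| <=
      K * Rintegral (@mu2 R) (@tau_pos R) (kern_bound d).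
  move=> mh hh; have mt := @measurable_tau_pos R.
  have ih := dominated_integrable d0 mh hh.
  apply: (le_trans (le_normr_Rintegral mt ih)).
  rewrite -RintegralZl//; last exact: integrable_kern_bound.
  apply: le_Rintegral => //; last exact: integrableZ_kern_bound.
  exact: (integrable_abse ih).
apply: (le_trans (normc_le_ReIm _)) => /=.
rewrite mulrCA [2 * _]mulr_natl mulr2n lerD//.
- by apply: I_le => // et t0; apply: le_trans (hK _ t0); exact: Re_le_normc.
- by apply: I_le => // et t0; apply: le_trans (hK _ t0); exact: Im_le_normc.
Qed.

Lemma dominated_pow (d : R) (n : nat) (h : R * R -> R) : 0 < d ->
  (exists2 C : R, 0 <= C & forall et, tau_pos et ->
    h et <= C * ((et.2 * (1 + `|et.1|)) ^+ n * kern_bound d et)) ->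
  exists2 C : R, 0 <= C & forall et, tau_pos et -> h et <= C * kern_bound (d / 2) et.
Proof.
move=> d0 [C C0 hC].
have d20 : 0 < d / 2 by lra.
have [M M0 hM] := powr_le_expR n d20.
exists (C * M); first exact: mulr_ge0.
move=> et t0; apply: (le_trans (hC _ t0)); rewrite -mulrA ler_wpM2l//.
rewrite /kern_bound; set y := et.2 * (1 + _).
have y0 : 0 <= y by rewrite mulr_ge0 ?addr_ge0// ltW.
rewrite mulrCA [M * _]mulrCA ler_wpM2l ?(ltW t0)//.
apply: (@le_trans _ _ (M * expR (d / 2 * y) * expR (- (d * y)))).
  by rewrite ler_wpM2r ?expR_ge0 ?hM.
rewrite -mulrA -expRD le_eqVlt; apply/orP; left; apply/eqP.
by congr (_ * expR _); field.
Qed.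

(* Differentiation under the integral sign in the parameter u of exp(u phi) k,
   by integrating the second-order Taylor remainder. *)
Lemma Cint_cexp_rem (phi k : R * R -> R[i]) (d : R) : 0 < d ->
  cmeasurable phi -> cmeasurable k -> dominated d k ->
  (forall et, tau_pos et -> normc (phi et) <= et.2 * (1 + `|et.1|)) ->
  exists K : R, forall u, normc u <= d / 2 ->
    normc (Cint (fun et => cexp (u * phi et) * k et) - Cint k
           - u * Cint (fun et => phi et * k et)) <= K * normc u ^+ 2.
Proof.
move=> d0 mphi mk dk hphi.
have d20 : 0 < d / 2 by lra.
have d40 : 0 < d / 2 / 2 by lra.
have [C C0 hC] := dk.
have mpk := cmeasurableM mphi mk.
have dpk : dominated (d / 2) (fun et => phi et * k et).
  apply: (@dominated_pow _ 1) => //; exists C => // et t0.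
  rewrite normcM expr1 mulrCA ler_pM ?normc_ge0//; [exact: hphi | exact: hC].
have mu u : cmeasurable (fun et => u * phi et).
  exact: cmeasurableM (cmeasurable_cst u) mphi.
have mek u : cmeasurable (fun et => cexp (u * phi et) * k et).
  by apply: cmeasurableM => //; exact: cmeasurable_cexp.
have shift_bound u et : tau_pos et -> normc u <= d / 2 ->
    expR (normc (u * phi et)) * kern_bound d et <= kern_bound (d / 2) et.
  move=> t0 hu; rewrite /kern_bound mulrCA ler_wpM2l ?(ltW t0)// -expRD ler_expR.
  have : normc (u * phi et) <= d / 2 * (et.2 * (1 + `|et.1|)).
    by rewrite normcM ler_pM ?normc_ge0 ?hphi.
  lra.
have dek u : normc u <= d / 2 -> dominated (d / 2) (fun et => cexp (u * phi et) * k et).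
  move=> hu; exists C => // et t0.
  rewrite normcM normc_cexp.
  apply: (@le_trans _ _ (expR (normc (u * phi et)) * (C * kern_bound d et))).
    rewrite ler_pM ?expR_ge0 ?normc_ge0 ?hC// ler_expR.
    exact: le_trans (ler_norm _) (Re_le_normc _).
  by rewrite mulrCA ler_wpM2l// shift_bound.
have [M M0 hM] : exists2 M : R, 0 <= M & forall et, tau_pos et ->
    (et.2 * (1 + `|et.1|)) ^+ 2 * kern_bound (d / 2) et <= M * kern_bound (d / 2 / 2) et.
  apply: (@dominated_pow _ 2) => //; exists 1 => // et t0.
  by rewrite mul1r.
exists (5 * C * M * (2 * Rintegral (@mu2 R) (@tau_pos R) (kern_bound (d / 2 / 2)))).
move=> u hu.
have ik := dominated_cintegrable d0 mk dk.
have iek := dominated_cintegrable d20 (mek u) (dek u hu).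
have ipk := dominated_cintegrable d20 mpk dpk.
have iupk : cintegrable (fun et => u * (phi et * k et)).
  apply: (@dominated_cintegrable (d / 2)) => //.
    exact: cmeasurableM (cmeasurable_cst u) mpk.
  have [C1 C10 hC1] := dpk; exists (normc u * C1).
    by rewrite mulr_ge0 ?normc_ge0.
  by move=> et t0; rewrite normcM -mulrA ler_wpM2l ?normc_ge0 ?hC1.
rewrite -CintZ// -CintB// -CintB//; last exact: cintegrableB.
rewrite mulrAC.
apply: (@le_trans _ _ (normc u ^+ 2 * (5 * C * M) *
    (2 * Rintegral (@mu2 R) (@tau_pos R) (kern_bound (d / 2 / 2))))); last first.
  by rewrite le_eqVlt; apply/orP; left; apply/eqP; ring.
apply: normc_Cint_le => //.
  apply: cmeasurableB; first exact: cmeasurableB.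
  exact: cmeasurableM (cmeasurable_cst u) mpk.
move=> et t0.
have -> : cexp (u * phi et) * k et - k et - u * (phi et * k et) =
   (cexp (u * phi et) - 1 - u * phi et) * k et by ring.
rewrite normcM.
set y := et.2 * (1 + `|et.1|) in hM.
have y0 : 0 <= y by rewrite mulr_ge0 ?addr_ge0// ltW.
set r := normc (u * phi et).
have hr : r ^+ 2 <= normc u ^+ 2 * y ^+ 2.
  rewrite -exprMn lerXn2r ?nnegrE ?normc_ge0//.
    exact: mulr_ge0 (normc_ge0 _) y0.
  by rewrite /r normcM ler_wpM2l ?normc_ge0 ?hphi.
apply: (@le_trans _ _ (5 * (r ^+ 2 * expR r) * (C * kern_bound d et))).
  by rewrite ler_pM ?normc_ge0 ?cexp_rem ?hC.
have -> : 5 * (r ^+ 2 * expR r) * (C * kern_bound d et) =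
  5 * C * (r ^+ 2 * (expR r * kern_bound d et)) by ring.
have -> : normc u ^+ 2 * (5 * C * M) * kern_bound (d / 2 / 2) et =
  5 * C * (normc u ^+ 2 * (M * kern_bound (d / 2 / 2) et)) by ring.
rewrite ler_wpM2l ?mulr_ge0//.
apply: (@le_trans _ _ (normc u ^+ 2 * y ^+ 2 * kern_bound (d / 2) et)).
  rewrite ler_pM ?sqr_ge0 ?shift_bound//.
  by rewrite mulr_ge0 ?expR_ge0 ?kern_bound_ge0.
by rewrite -mulrA ler_wpM2l ?sqr_ge0 ?hM.
Qed.

End ComplexIntegral.

(** * The Szego kernel *)

Section SzegoKernel.
Variables (R : realType) (p q : R).
Implicit Types (Z T u : R[i]) (a m : nat).
Local Notation b := (bq p q).

Definition phiZ (et : R * R) : R[i] := ((et.1 * et.2)%:C)%C.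
Definition phiT (et : R * R) : R[i] := ('i)%C * (et.2%:C)%C.

Definition skern a m Z T (et : R * R) : R[i] :=
  cexp (phiZ et * Z + phiT et * T)
  * ((et.1 ^+ a * et.2 ^+ m / Nfun b et.1 et.2)%:C)%C.

Lemma cmeasurable_phiZ : cmeasurable phiZ.
Proof. by apply: cmeasurable_real; apply: measurable_funTS; exact: measurable_funM. Qed.

Lemma cmeasurable_phiT : cmeasurable phiT.
Proof.
apply: cmeasurableM; first exact: cmeasurable_cst.
by apply: cmeasurable_real; apply: measurable_funTS.
Qed.

Lemma normc_phiZ et : tau_pos et -> normc (phiZ et) <= et.2 * (1 + `|et.1|).
Proof.
move=> t0; have {}t0 : 0 < et.2 := t0; rewrite /phiZ normc_real normrM (gtr0_norm t0) mulrC.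
by rewrite ler_pM2l// lerDr.
Qed.

Lemma normc_phiT et : tau_pos et -> normc (phiT et) <= et.2 * (1 + `|et.1|).
Proof.
move=> t0; have {}t0 : 0 < et.2 := t0; rewrite /phiT normcM normc_i normc_real mul1r (gtr0_norm t0).
by rewrite ler_peMr ?lerDl// ltW.
Qed.

Lemma cmeasurable_skern a m Z T : cmeasurable (skern a m Z T).
Proof.
apply: cmeasurableM.
  apply: cmeasurable_cexp; apply: cmeasurableD.
    exact: cmeasurableM cmeasurable_phiZ (cmeasurable_cst _).
  exact: cmeasurableM cmeasurable_phiT (cmeasurable_cst _).
apply: cmeasurable_real; apply: measurable_funTS.
apply: measurable_funM.
  by apply: measurable_funM; exact: measurable_funX.
have -> : (fun et => (Nfun b et.1 et.2)^-1) =
    (fun et => Nfun b et.1 et.2 `^ (-1)).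
  by apply/funext => et; rewrite powR_inv1// Nfun_ge0.
exact: (measurableT_comp (measurable_powR (-1)) (@measurable_Nfun R p q)).
Qed.

Lemma normc_skern a m Z T et : tau_pos et -> normc (skern a m Z T et) =
  expR (et.2 * (et.1 * complex.Re Z - complex.Im T)) *
  (`|et.1| ^+ a * et.2 ^+ m / Nfun b et.1 et.2).
Proof.
move=> t0; have {}t0 : 0 < et.2 := t0; rewrite normcM normc_cexp normc_real; congr (expR _ * _).
  case: Z T => [x y] [s t] /=; ring.
by rewrite !normrM normfV !normrX (gtr0_norm t0) (ger0_norm (Nfun_ge0 _ _ _)).
Qed.

Lemma skern_dominated Z T : leg_gap b (complex.Re Z / 2) (complex.Im T) ->
  exists2 d : R, 0 < d & forall a m, (a < m)%N -> dominated d (skern a m Z T).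
Proof.
move=> /leg_gap_linear[e e0 [L hL]].
have L0 : 0 <= L by have [l hl _] := hL 0; exact: le_trans (normr_ge0 l) hl.
have [C C0 hC] := @Nfun_inv_le R p q L L0.
exists e => // a m am.
have [M1 M10 hM1] := powr_le_expR m.-1 e0.
have [M2 M20 hM2] := powr_le_expR m e0.
exists (C * (M1 + M2)); first by rewrite mulr_ge0 ?addr_ge0.
move=> et t0; rewrite normc_skern// /kern_bound.
have {}t0 : 0 < et.2 := t0.
have m0 : (0 < m)%N by exact: leq_ltn_trans am.
have am1 : (a <= m.-1)%N by rewrite -ltnS prednK.
set eta := et.1; set tau := et.2 in t0 *.
set y := tau * (1 + `|eta|).
have tau_y : tau <= y by rewrite ler_peMr ?lerDl// ltW.
have eta_y : tau * `|eta| <= y by rewrite ler_pM2l// lerDr.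
have y0 : 0 <= y by exact: le_trans (ltW t0) tau_y.
have [l lL hl] := hL eta.
set P := `|eta| ^+ a * tau ^+ m.
have P0 : 0 <= P by rewrite mulr_ge0 ?exprn_ge0// ltW.
have hP : P * (1 + tau) <= tau * (y ^+ m.-1 + y ^+ m).
  have -> : P = tau * (tau ^+ (m.-1 - a) * (tau * `|eta|) ^+ a).
    rewrite /P; have -> : tau ^+ m = tau * (tau ^+ (m.-1 - a) * tau ^+ a) :> R.
      by rewrite -exprD subnK// -exprS prednK.
    by rewrite exprMn; ring.
  rewrite -mulrA ler_pM2l//.
  have -> : y ^+ m.-1 + y ^+ m = y ^+ m.-1 * (1 + y).
    by rewrite mulrDr mulr1 -exprSr prednK.
  rewrite ler_pM ?mulr_ge0 ?exprn_ge0 ?mulr_ge0 ?addr_ge0 ?lerD2l ?(ltW t0)//.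
  have -> : m.-1 = (m.-1 - a + a)%N by rewrite subnK.
  rewrite addnK exprD ler_pM ?exprn_ge0 ?mulr_ge0 ?(ltW t0)//.
    by rewrite lerXn2r ?nnegrE// ltW.
  by rewrite lerXn2r ?nnegrE// mulr_ge0 ?(ltW t0).
set E := expR _.
apply: (@le_trans _ _ (E * (P * (C * (1 + tau) * expR (- (2 * tau * (eta * l - b l))))))).
  by rewrite ler_wpM2l ?expR_ge0// ler_wpM2l// hC.
have -> : E * (P * (C * (1 + tau) * expR (- (2 * tau * (eta * l - b l))))) =
   C * (P * (1 + tau) * (E * expR (- (2 * tau * (eta * l - b l))))) by ring.
have hE : E * expR (- (2 * tau * (eta * l - b l))) <= expR (- (2 * e * y)).
  rewrite -expRD ler_expR /y.
  have := ler_wpM2l (ltW t0) hl; lra.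
rewrite -[leRHS]mulrA ler_wpM2l//.
apply: (@le_trans _ _ (tau * (y ^+ m.-1 + y ^+ m) * expR (- (2 * e * y)))).
  apply: ler_pM => //; last by rewrite mulr_ge0 ?expR_ge0.
  by apply: mulr_ge0 => //; rewrite addr_ge0// ltW.
rewrite [leRHS]mulrCA -[leLHS]mulrA ler_pM2l//.
apply: (@le_trans _ _ ((M1 + M2) * expR (e * y) * expR (- (2 * e * y)))).
  by rewrite ler_wpM2r ?expR_ge0// mulrDl lerD ?hM1 ?hM2.
rewrite -mulrA -expRD le_eqVlt; apply/orP; left; apply/eqP.
by congr (_ * expR _); ring.
Qed.

Lemma skernZ a m Z T u :
  skern a m (Z + u) T = (fun et => cexp (u * phiZ et) * skern a m Z T et).
Proof.
by apply/funext => et; rewrite /skern mulrA -cexpD; congr (cexp _ * _); ring.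
Qed.

Lemma skernT a m Z T u :
  skern a m Z (T + u) = (fun et => cexp (u * phiT et) * skern a m Z T et).
Proof.
by apply/funext => et; rewrite /skern mulrA -cexpD; congr (cexp _ * _); ring.
Qed.

Lemma phiZ_skern a m Z T :
  (fun et => phiZ et * skern a m Z T et) = skern a.+1 m.+1 Z T.
Proof.
apply/funext => et; rewrite /skern mulrCA; congr (_ * _).
by apply/eqP; rewrite eq_complex /=; apply/andP; split; apply/eqP;
  rewrite ?exprS; ring.
Qed.

Lemma phiT_skern a m Z T :
  (fun et => phiT et * skern a m Z T et) = (fun et => 'i%C * skern a m.+1 Z T et).
Proof.
apply/funext => et; rewrite /skern mulrCA [RHS]mulrCA; congr (_ * _).
by apply/eqP; rewrite eq_complex /=; apply/andP; split; apply/eqP;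
  rewrite ?exprS; ring.
Qed.

Lemma Cint_skern_remZ a m Z T : (a < m)%N ->
  leg_gap b (complex.Re Z / 2) (complex.Im T) ->
  exists2 d : R, 0 < d & exists K, forall u, normc u <= d ->
    normc (Cint (skern a m (Z + u) T) - Cint (skern a m Z T)
           - u * Cint (skern a.+1 m.+1 Z T)) <= K * normc u ^+ 2.
Proof.
move=> am /skern_dominated[d d0 hd]; exists (d / 2); first lra.
have [K hK] := Cint_cexp_rem d0 cmeasurable_phiZ (cmeasurable_skern a m Z T)
  (hd a m am) normc_phiZ.
by exists K => u hu; rewrite skernZ -phiZ_skern; exact: hK.
Qed.

Lemma Cint_skern_remT a m Z T : (a < m)%N ->
  leg_gap b (complex.Re Z / 2) (complex.Im T) ->
  exists2 d : R, 0 < d & exists K, forall u, normc u <= d ->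
    normc (Cint (skern a m Z (T + u)) - Cint (skern a m Z T)
           - u * ('i%C * Cint (skern a m.+1 Z T))) <= K * normc u ^+ 2.
Proof.
move=> am /skern_dominated[d d0 hd]; exists (d / 2); first lra.
have [K hK] := Cint_cexp_rem d0 cmeasurable_phiT (cmeasurable_skern a m Z T)
  (hd a m am) normc_phiT.
exists K => u hu; rewrite skernT -CintZ; last first.
  by apply: (dominated_cintegrable d0); [exact: cmeasurable_skern | exact/hd/ltnW].
by rewrite -phiT_skern; exact: hK.
Qed.

End SzegoKernel.

Lemma ReD (R : realType) (x y : R[i]) : complex.Re (x + y) = complex.Re x + complex.Re y.
Proof. by case: x y => a b []. Qed.

Lemma ReB (R : realType) (x y : R[i]) : complex.Re (x - y) = complex.Re x - complex.Re y.
Proof. by case: x y => a b []. Qed.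

Lemma ImB (R : realType) (x y : R[i]) : complex.Im (x - y) = complex.Im x - complex.Im y.
Proof. by case: x y => a b []. Qed.

Lemma Re_conj (R : realType) (x : R[i]) : complex.Re (x^*) = complex.Re x.
Proof. by case: x. Qed.

Lemma Im_conj (R : realType) (x : R[i]) : complex.Im (x^*) = - complex.Im x.
Proof. by case: x. Qed.

Lemma iintE (R : realType) (p q : R) a m (z w : R[i] * R[i]) :
  iint (bq p q) a m z w = Cint (skern p q a m (z.1 + w.1^*) (z.2 - w.2^*)).
Proof. by []. Qed.

Lemma region_skern (R : realType) (p q : R) (z w : R[i] * R[i]) :
  region (bq p q) z w <->
  leg_gap (bq p q) (complex.Re (z.1 + w.1^*) / 2) (complex.Im (z.2 - w.2^*)).
Proof. by rewrite regionE ReD ImB Re_conj Im_conj opprK. Qed.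

Lemma region_abs_conv (R : realType) (p q : R) a m (z w : R[i] * R[i]) :
  (a < m)%N -> region (bq p q) z w -> abs_conv (kern (bq p q) a m z w).
Proof.
move=> am /region_skern/skern_dominated[d d0 hd].
by apply: (dominated_abs_conv d0 (cmeasurable_skern p q a m _ _)); exact: hd.
Qed.

Lemma region_open (R : realType) (p q : R) :
  open [set zw : ((R[i])^o * (R[i])^o) * ((R[i])^o * (R[i])^o)
          | region (bq p q) zw.1 zw.2].
Proof.
rewrite openE => -[[z1 z2] [w1 w2]] /= /regionE/leg_gap_open[d d0 hd].
rewrite /interior; apply/nbhs_ballP; exists (((d / 2)%:C)%C) => /=.
  by rewrite ltcR; lra.
move=> [[z1' z2'] [w1' w2']] /= [[/= h1 h2] [/= h3 h4]].
have ballR (x y : R[i]) : ball (x : (R[i])^o) ((d / 2)%:C)%C (y : (R[i])^o) ->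
    `|complex.Re y - complex.Re x| < d / 2 /\ `|complex.Im y - complex.Im x| < d / 2.
  rewrite -ball_normE /= [`|_|]/((normc (x - y))%:C)%C ltcR => hxy.
  rewrite distrC [`|complex.Im y - _|]distrC -ImB -ReB.
  split; [exact: le_lt_trans (Re_le_normc _) hxy|exact: le_lt_trans (Im_le_normc _) hxy].
have [a1 _] := ballR _ _ h1; have [_ a2] := ballR _ _ h2.
have [a3 _] := ballR _ _ h3; have [_ a4] := ballR _ _ h4.
apply/regionE; apply: hd => /=.
- have -> : (complex.Re z1' + complex.Re w1') / 2 - (complex.Re z1 + complex.Re w1) / 2 =
    (complex.Re z1' - complex.Re z1) / 2 + (complex.Re w1' - complex.Re w1) / 2 by field.
  apply: le_lt_trans (ler_normD _ _) _.
  rewrite !normrM (ger0_norm (_ : 0 <= 2^-1)); lra.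
- have -> : complex.Im z2' + complex.Im w2' - (complex.Im z2 + complex.Im w2) =
    (complex.Im z2' - complex.Im z2) + (complex.Im w2' - complex.Im w2) by ring.
  apply: le_lt_trans (ler_normD _ _) _; lra.
Qed.

Lemma region_off_Sigma (R : realType) (p q : R) (z w : R[i] * R[i]) : p < 0 ->
  Omega_bar (bq p q) z -> Omega_bar (bq p q) w -> ~ Sigma p z w ->
  region (bq p q) z w.
Proof.
move=> p0 hz hw hS; apply/regionE/leg_gap_off_Sigma => //.
exact: lerD.
Qed.

Lemma is_derive_Cint_skernZ (R : realType) (p q : R) (a m : nat) (Z T c x : R[i])
    (f : (R[i])^o -> (R[i])^o) :
  (a < m)%N -> leg_gap (bq p q) (complex.Re Z / 2) (complex.Im T) ->
  (forall u : R[i], f (x + u) = c * Cint (skern p q a m (Z + u) T)) ->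
  is_derive (x : (R[i])^o) (1 : (R[i])^o) f
    (c * Cint (skern p q a.+1 m.+1 Z T) : (R[i])^o).
Proof.
move=> am hg hf; have [d d0 [K hK]] := Cint_skern_remZ am hg.
apply: (@is_derive_quadratic _ _ _ _ (normc c * K) d d0) => u hu.
have -> : f x = c * Cint (skern p q a m Z T) by rewrite -[x]addr0 hf addr0.
rewrite hf mulrCA -!mulrBr normcM -mulrA ler_wpM2l ?normc_ge0//.
exact: hK.
Qed.

Lemma is_derive_Cint_skernT (R : realType) (p q : R) (a m : nat) (Z T c s x : R[i])
    (f : (R[i])^o -> (R[i])^o) :
  normc s = 1 -> (a < m)%N ->
  leg_gap (bq p q) (complex.Re Z / 2) (complex.Im T) ->
  (forall u : R[i], f (x + u) = c * Cint (skern p q a m Z (T + s * u))) ->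
  is_derive (x : (R[i])^o) (1 : (R[i])^o) f
    (c * (s * 'i%C) * Cint (skern p q a m.+1 Z T) : (R[i])^o).
Proof.
move=> s1 am hg hf; have [d d0 [K hK]] := Cint_skern_remT am hg.
apply: (@is_derive_quadratic _ _ _ _ (normc c * K) d d0) => u hu.
have -> : f x = c * Cint (skern p q a m Z T) by rewrite -[x]addr0 hf mulr0 addr0.
have nsu : normc (s * u) = normc u by rewrite normcM s1 mul1r.
rewrite hf.
have -> : u * (c * (s * 'i%C) * Cint (skern p q a m.+1 Z T)) =
  c * (s * u * ('i%C * Cint (skern p q a m.+1 Z T))) by ring.
rewrite -!mulrBr normcM -[leRHS]mulrA ler_wpM2l ?normc_ge0// -nsu.
by apply: hK; rewrite nsu.
Qed.

Theorem theorem2p1 (R : realType) (p q : R) (hp : p < 0) (c : R[i]) :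
  let b := bq p q in
  (* the integral defining S is absolutely convergent in the region *)
  (forall z w : R[i] * R[i], region b z w -> abs_conv (kern b 0 1 z w)) /\
  (* the region is an open neighbourhood of (Omega_bar x Omega_bar) \ Sigma *)
  open [set zw : ((R[i])^o * (R[i])^o) * ((R[i])^o * (R[i])^o)
          | region b zw.1 zw.2] /\
  (forall z w : R[i] * R[i],
     Omega_bar b z -> Omega_bar b w -> ~ Sigma p z w -> region b z w) /\
  (* the differentiated integrals are absolutely convergent in the region *)
  (forall (i1 j1 i2 j2 : nat) (z w : R[i] * R[i]), region b z w ->
     abs_conv (kern b (i1 + j1) (i1 + j1 + i2 + j2).+1 z w)) /\
  (* d^{i1}_{z1} d^{j1}_{conj w1} d^{i2}_{z2} d^{j2}_{conj w2} S
       = c' (i1,j1,i2,j2) * \iint e^{..} eta^{i1+j1} tau^{i1+j1+i2+j2+1} / N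
     in the region: the partial derivatives of D_{i1 j1 i2 j2} := c' * iint
     in each variable exist and equal the next D's, with D_{0000} = S. *)
  (exists cst : nat -> nat -> nat -> nat -> R[i],
     cst 0 0 0 0 = c /\
     let D i1 j1 i2 j2 (z w : R[i] * R[i]) : (R[i])^o :=
       cst i1 j1 i2 j2 * iint b (i1 + j1) (i1 + j1 + i2 + j2).+1 z w in
     (forall z w, D 0 0 0 0 z w = szego b c z w) /\
     forall (i1 j1 i2 j2 : nat) (z w : R[i] * R[i]), region b z w ->
       is_derive (z.1 : (R[i])^o) (1 : (R[i])^o)
         (fun zeta : (R[i])^o => D i1 j1 i2 j2 (zeta, z.2) w)
         (D i1.+1 j1 i2 j2 z w) /\
       is_derive ((w.1)^* : (R[i])^o) (1 : (R[i])^o)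
         (fun om : (R[i])^o => D i1 j1 i2 j2 z ((om : R[i])^*, w.2))
         (D i1 j1.+1 i2 j2 z w) /\
       is_derive (z.2 : (R[i])^o) (1 : (R[i])^o)
         (fun zeta : (R[i])^o => D i1 j1 i2 j2 (z.1, zeta) w)
         (D i1 j1 i2.+1 j2 z w) /\
       is_derive ((w.2)^* : (R[i])^o) (1 : (R[i])^o)
         (fun om : (R[i])^o => D i1 j1 i2 j2 z (w.1, (om : R[i])^*))
         (D i1 j1 i2 j2.+1 z w)).
Proof.
move=> b; split; first by move=> z w; exact: region_abs_conv.
split; first exact: region_open.
split; first by move=> z w; exact: region_off_Sigma.
split.
  move=> i1 j1 i2 j2 z w; apply: region_abs_conv.
  by rewrite ltnS -addnA leq_addr.
exists (fun _ _ i2 j2 => c * 'i%C ^+ i2 * (- 'i%C) ^+ j2); split.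
  by rewrite !expr0 !mulr1.
move=> D; split.
  by move=> z w; rewrite /D /szego !expr0 !mulr1.
move=> i1 j1 i2 j2 z w /region_skern hg.
have am : (i1 + j1 < (i1 + j1 + i2 + j2).+1)%N by rewrite ltnS -addnA leq_addr.
split; last split; last split.
- apply: (is_derive_Cint_skernZ am hg) => u.
  by rewrite /D iintE /= addrAC.
- have -> : D i1 j1.+1 i2 j2 z w = c * 'i%C ^+ i2 * (- 'i%C) ^+ j2 *
     Cint (skern p q (i1 + j1).+1 (i1 + j1 + i2 + j2).+2 (z.1 + w.1^*) (z.2 - w.2^*)).
    by rewrite /D iintE addnS !addSn.
  apply: (is_derive_Cint_skernZ am hg) => u.
  by rewrite /D iintE /= conjCK addrA.
- have -> : D i1 j1 i2.+1 j2 z w = c * 'i%C ^+ i2 * (- 'i%C) ^+ j2 * (1 * 'i%C) *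
     Cint (skern p q (i1 + j1) (i1 + j1 + i2 + j2).+2 (z.1 + w.1^*) (z.2 - w.2^*)).
    by rewrite /D iintE addnS !addSn exprSr mul1r -!mulrA [X in _ * (_ * X)]mulrCA.
  apply: (is_derive_Cint_skernT _ am hg) => [|u]; first exact: normc1.
  by rewrite /D iintE /= mul1r addrAC.
- have -> : D i1 j1 i2 j2.+1 z w = c * 'i%C ^+ i2 * (- 'i%C) ^+ j2 * (- 1 * 'i%C) *
     Cint (skern p q (i1 + j1) (i1 + j1 + i2 + j2).+2 (z.1 + w.1^*) (z.2 - w.2^*)).
    by rewrite /D iintE addnS exprSr mulN1r -!mulrA.
  apply: (is_derive_Cint_skernT _ am hg) => [|u]; first by rewrite normcN normc1.
  by rewrite /D iintE /= conjCK mulN1r opprD addrA.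
Qed.
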